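(* Let $\mathcal{R}$ be a commutative ring with unity, let $\mathcal{A}$ and $\mathcal{B}$ be $\mathcal{R}$-algebras, let $\mathcal{M}$ be an $(\mathcal{A},\mathcal{B})$-bimodule, and let $\mathcal{T}=Tri(\mathcal{A},\mathcal{M},\mathcal{B})$ be the associated triangular algebra. Suppose that $\mathcal{A}$ and $\mathcal{B}$ are SLIP algebras and that every local left multiplier from $\mathcal{B}$ into $\mathcal{M}$ is a left multiplier. Then $\mathcal{T}$ is a SLIP algebra.
   Context: All algebras are associative $\mathcal{R}$-algebras with unity $1$ and all modules and bimodules are unital; modules over an $\mathcal{R}$-algebra are $\mathcal{R}$-modules in the compatible way (for bimodules, $rm=mr$ for $r\in\mathcal{R}$). The triangular algebra $Tri(\mathcal{A},\mathcal{M},\mathcal{B})$ is the algebra of all matrices $\begin{pmatrix} a & m\\ 0 & b\end{pmatrix}$ with $a\in\mathcal{A}$, $b\in\mathcal{B}$, $m\in\mathcal{M}$, under the usual matrix operations. For an algebra $\mathcal{C}$ and a right $\mathcal{C}$-module $\mathcal{X}$, an $\mathcal{R}$-linear map $\psi:\mathcal{C}\to\mathcal{X}$ is a left multiplier if $\psi(c)=\psi(1)c$ for all $c\in\mathcal{C}$; it is a local left multiplier if for each $c\in\mathcal{C}$ there exists $x_c\in\mathcal{X}$ with $\psi(c)=x_c c$. An $\mathcal{R}$-linear map $\psi:\mathcal{C}\to\mathcal{C}$ is LIP (left-ideal-preserving) if $\psi(\mathcal{J})\subseteq\mathcal{J}$ for every left ideal $\mathcal{J}$ of $\mathcal{C}$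 (equivalently, $\psi$ is a local left multiplier from $\mathcal{C}$ to $\mathcal{C}$). The algebra $\mathcal{C}$ is SLIP if every LIP map on $\mathcal{C}$ is a left multiplier. *)

(* Defs.v *)
From HB Require Import structures.
From mathcomp Require Import all_boot all_algebra.

Set Implicit Arguments.
Unset Strict Implicit.
Unset Printing Implicit Defensive.

Import GRing.Theory.

Local Open Scope ring_scope.

(* The library's algType R requires 1 != 0, whereas the zero algebra is allowed
   here.  GRing.PzRing and GRing.Lmodule cannot be joined directly (GRing.Algebra
   does not inherit from such a join), so the scalar action is a field of the
   mixin and the lmodType R structure is derived from it. *)
HB.mixin Record PzRing_isPzAlgebra (R : comPzRingType) A of GRing.PzRing A := {
  algscale : R -> A -> A;
  algscaleA : forall r s x, algscale r (algscale s x) = algscale (r * s) x;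
  algscale1 : left_id 1 algscale;
  algscaleDr : right_distributive algscale +%R;
  algscaleDl : forall x, {morph algscale^~ x : r s / r + s};
  algscaleAl : forall r x y, algscale r (x * y) = algscale r x * y;
  algscaleAr : forall r x y, algscale r (x * y) = x * algscale r y
}.

#[short(type="pzAlgType")]
HB.structure Definition PzAlgebra (R : comPzRingType) :=
  {A of GRing.PzRing A & PzRing_isPzAlgebra R A}.

HB.instance Definition _ (R : comPzRingType) (A : pzAlgType R) :=
  GRing.Zmodule_isLmodule.Build R (PzAlgebra.sort A)
    algscaleA algscale1 algscaleDr algscaleDl.

Lemma pzscalerAl (R : comPzRingType) (A : pzAlgType R) (r : R) (x y : A) :
  r *: (x * y) = (r *: x) * y.
Proof. exact: algscaleAl. Qed.

Lemma pzscalerAr (R : comPzRingType) (A : pzAlgType R) (r : R) (x y : A) :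
  r *: (x * y) = x * (r *: y).
Proof. exact: algscaleAr. Qed.

HB.mixin Record Lmodule_isRightModule (R : comPzRingType) (C : pzAlgType R) X
    of GRing.Lmodule R X := {
  ract : X -> C -> X;
  ractA : forall x c d, ract x (c * d) = ract (ract x c) d;
  ract1 : forall x, ract x 1 = x;
  ractDl : forall x y c, ract (x + y) c = ract x c + ract y c;
  ractDr : forall x c d, ract x (c + d) = ract x c + ract x d;
  ractZ : forall (r : R) x c, ract x (r *: c) = r *: ract x c
}.

#[short(type="rightModType")]
HB.structure Definition RightModule (R : comPzRingType) (C : pzAlgType R) :=
  {X of GRing.Lmodule R X & Lmodule_isRightModule R C X}.

(* The identities ract (r *: x) c = r *: ract x c and
   lact a (r *: m) = r *: lact a m follow from the axioms, using unitality.
   The axioms ractZ and lactZ about the same R-module structure on M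
   express r m = m r. *)
HB.mixin Record RightModule_isBimodule (R : comPzRingType) (A B : pzAlgType R) M
    of RightModule R B M := {
  lact : A -> M -> M;
  lactA : forall a a' m, lact (a * a') m = lact a (lact a' m);
  lact1 : forall m, lact 1 m = m;
  lactDl : forall a a' m, lact (a + a') m = lact a m + lact a' m;
  lactDr : forall a m m', lact a (m + m') = lact a m + lact a m';
  lactZ : forall (r : R) a m, lact (r *: a) m = r *: lact a m;
  lact_ract : forall a m (b : B), ract (lact a m) b = lact a (ract m b)
}.

#[short(type="bimodType")]
HB.structure Definition Bimodule (R : comPzRingType) (A B : pzAlgType R) :=
  {M of RightModule R B M & RightModule_isBimodule R A B M}.

HB.instance Definition _ (R : comPzRingType) (C : pzAlgType R) :=
  Lmodule_isRightModule.Build R C (PzAlgebra.sort C)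
    (fun x c d => mulrA x c d) (fun x => mulr1 x) (fun x y c => mulrDl x y c)
    (fun x c d => mulrDr x c d) (fun r x c => esym (pzscalerAr r x c)).

Section ActionTheory.
Variables (R : comPzRingType) (A B : pzAlgType R).

Lemma ractZl (X : rightModType B) (r : R) (x : X) (b : B) :
  ract (r *: x) b = r *: ract x b.
Proof.
by rewrite -{1}(ract1 (s := X) x) -ractZ -ractA -pzscalerAl mul1r ractZ.
Qed.

Lemma lactZr (M : bimodType A B) (r : R) (a : A) (m : M) :
  lact a (r *: m) = r *: lact a m.
Proof.
by rewrite -{1}(lact1 (s := M) m) -lactZ -lactA -pzscalerAr mulr1 lactZ.
Qed.

Lemma ract0l (X : rightModType B) (b : B) : ract (0 : X) b = 0.
Proof. by apply: (addrI (ract (0 : X) b)); rewrite -ractDl !addr0. Qed.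

Lemma ract0r (X : rightModType B) (x : X) : ract x (0 : B) = 0.
Proof. by apply: (addrI (ract x 0)); rewrite -ractDr !addr0. Qed.

Lemma lact0l (M : bimodType A B) (m : M) : lact (0 : A) m = 0.
Proof. by apply: (addrI (lact 0 m)); rewrite -lactDl !addr0. Qed.

Lemma lact0r (M : bimodType A B) (a : A) : lact a (0 : M) = 0.
Proof. by apply: (addrI (lact a 0)); rewrite -lactDr !addr0. Qed.

End ActionTheory.

(* The formal matrix with rows (tri11, tri12) and (0, tri22). *)
Record triangular (R : comPzRingType) (A B : pzAlgType R) (M : bimodType A B) :=
  MkTri { tri11 : A; tri12 : M; tri22 : B }.

Notation Tri A M B := (@triangular _ A B M).

Section TriangularAlgebra.
Variables (R : comPzRingType) (A B : pzAlgType R) (M : bimodType A B).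

Local Notation T := (Tri A M B).
Implicit Types t u v : T.

Definition tri_tuple t : A * M * B := (tri11 t, tri12 t, tri22 t).
Definition tuple_tri (p : A * M * B) : T := MkTri p.1.1 p.1.2 p.2.

Lemma tri_tupleK : cancel tri_tuple tuple_tri.
Proof. by case. Qed.

HB.instance Definition _ := Choice.copy T (can_type tri_tupleK).

Definition tri0 : T := MkTri 0 0 0.
Definition tri1 : T := MkTri 1 0 1.
Definition tri_opp t : T := MkTri (- tri11 t) (- tri12 t) (- tri22 t).
Definition tri_add t u : T :=
  MkTri (tri11 t + tri11 u) (tri12 t + tri12 u) (tri22 t + tri22 u).
Definition tri_mul t u : T :=
  MkTri (tri11 t * tri11 u)
        (lact (tri11 t) (tri12 u) + ract (tri12 t) (tri22 u))
        (tri22 t * tri22 u).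
Definition tri_scale (r : R) t : T :=
  MkTri (r *: tri11 t) (r *: tri12 t) (r *: tri22 t).

Lemma tri_addA : associative tri_add.
Proof. by move=> t u v; rewrite /tri_add /= !addrA. Qed.

Lemma tri_addC : commutative tri_add.
Proof.
by move=> t u; congr MkTri; rewrite addrC.
Qed.

Lemma tri_add0 : left_id tri0 tri_add.
Proof. by case=> a m b; rewrite /tri_add /= !add0r. Qed.

Lemma tri_addN : left_inverse tri0 tri_opp tri_add.
Proof. by move=> t; rewrite /tri_add /= !addNr. Qed.

HB.instance Definition _ :=
  GRing.isZmodule.Build T tri_addA tri_addC tri_add0 tri_addN.

Lemma tri_mulA : associative tri_mul.
Proof.
move=> t u v; rewrite /tri_mul /=; congr MkTri; rewrite ?mulrA //.
by rewrite lactDr ractDl lactA ractA lact_ract addrA.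
Qed.

Lemma tri_mul1 : left_id tri1 tri_mul.
Proof. by case=> a m b; rewrite /tri_mul /= !mul1r lact1 ract0l addr0. Qed.

Lemma tri_mulr1 : right_id tri1 tri_mul.
Proof. by case=> a m b; rewrite /tri_mul /= !mulr1 ract1 lact0r add0r. Qed.

Lemma tri_mulDl : left_distributive tri_mul +%R.
Proof.
move=> t u v; congr MkTri => /=; rewrite ?mulrDl //.
by rewrite lactDl ractDl addrACA.
Qed.

Lemma tri_mulDr : right_distributive tri_mul +%R.
Proof.
move=> t u v; congr MkTri => /=; rewrite ?mulrDr //.
by rewrite lactDr ractDr addrACA.
Qed.

HB.instance Definition _ :=
  GRing.Zmodule_isPzRing.Build T
    tri_mulA tri_mul1 tri_mulr1 tri_mulDl tri_mulDr.

Lemma tri_scaleA r s t : tri_scale r (tri_scale s t) = tri_scale (r * s) t.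
Proof. by rewrite /tri_scale /= !scalerA. Qed.

Lemma tri_scale1 : left_id 1 tri_scale.
Proof. by case=> a m b; rewrite /tri_scale /= !scale1r. Qed.

Lemma tri_scaleDr : right_distributive tri_scale +%R.
Proof. by move=> r t u; congr MkTri => /=; rewrite scalerDr. Qed.

Lemma tri_scaleDl t : {morph tri_scale^~ t : r s / r + s}.
Proof. by move=> r s; congr MkTri => /=; rewrite scalerDl. Qed.

Lemma tri_scaleAl r t u : tri_scale r (t * u) = tri_scale r t * u.
Proof.
congr MkTri => /=; rewrite ?pzscalerAl //.
by rewrite scalerDr lactZ ractZl.
Qed.

Lemma tri_scaleAr r t u : tri_scale r (t * u) = t * tri_scale r u.
Proof.
congr MkTri => /=; rewrite ?pzscalerAr //.
by rewrite scalerDr lactZr ractZ.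
Qed.

HB.instance Definition _ :=
  PzRing_isPzAlgebra.Build R T
    tri_scaleA tri_scale1 tri_scaleDr tri_scaleDl tri_scaleAl tri_scaleAr.

HB.instance Definition _ := GRing.Lmodule.copy T (PzAlgebra.sort T).

End TriangularAlgebra.

Section Multipliers.
Variables (R : comPzRingType) (C : pzAlgType R).

Definition left_multiplier (X : rightModType C) (psi : {linear C -> X}) : Prop :=
  forall c : C, psi c = ract (psi 1) c.

Definition local_left_multiplier (X : rightModType C)
    (psi : {linear C -> X}) : Prop :=
  forall c : C, exists x : X, psi c = ract x c.

Definition left_ideal (J : C -> Prop) : Prop :=
  [/\ J 0,
      forall x y, J x -> J y -> J (x - y)
    & forall c x, J x -> J (c * x)].

Definition LIP (psi : {linear C -> C}) : Prop :=
  forall J : C -> Prop, left_ideal J -> forall c, J c -> J (psi c).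

Definition SLIP : Prop :=
  forall psi : {linear C -> C}, LIP psi -> left_multiplier psi.

End Multipliers.

(* Main.v *)
Require Import Defs.
From HB Require Import structures.
From mathcomp Require Import all_boot all_algebra.

(** Write (a, m, b) for the matrix with rows (a, m) and (0, b).  Applied to
    principal left ideals, the LIP property says that psi t is a left multiple
    x_t t of t; this pointwise form is the one that passes to the corners.

    Multiplying on the left preserves the first column (a, 0, 0) and the second
    column (0, m, b), so psi does too.  On the first column psi induces a local
    left multiplier of A, and on the elements (0, 0, b) it induces local left
    multipliers from B to M and from B to B.  The hypotheses make all three
    genuine: psi (a, 0, 0) = (alpha a, 0, 0) and
    psi (0, 0, b) = (0, mu b, beta b), where psi 1 = (alpha, mu, beta).

    The corner M is not an algebra, and no hypothesis speaks of the map that psi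
    induces on it.  It is reached through (1, m, 0): from
    psi (1, m, 0) = x (1, m, 0) = (x11, x11 m, 0) the entry 1 shows that
    x11 = alpha, whatever m is, so psi (0, m, 0) = (0, alpha m, 0).  Adding the
    three pieces gives psi (a, m, b) = (alpha a, alpha m + mu b, beta b), which is
    psi 1 (a, m, b) (see [left_multiplier_of_corners]). *)

Set Implicit Arguments.
Unset Strict Implicit.
Unset Printing Implicit Defensive.

Import GRing.Theory.

Local Open Scope ring_scope.

(** The forward direction tests psi on the left ideal generated by c. *)
Lemma LIP_iff_local_left_multiplier (R : comPzRingType) (C : pzAlgType R)
    (psi : {linear C -> C}) : LIP psi <-> local_left_multiplier psi.
Proof.
split=> [psi_LIP c | psi_loc J [_ _ JM] c Jc]; last first.
  by have [x ->] := psi_loc c; apply: JM.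
apply: (psi_LIP (fun y => exists x : C, y = x * c)); last first.
  by exists 1; rewrite mul1r.
split=> [|_ _ [x ->] [y ->]|d _ [x ->]].
- by exists 0; rewrite mul0r.
- by exists (x - y); rewrite mulrBl.
- by exists (d * x); rewrite mulrA.
Qed.

Section TriangularCorners.
Variables (R : comPzRingType) (A B : pzAlgType R) (M : bimodType A B).
Local Notation T := (Tri A M B).

Definition tri_in11 (a : A) : T := MkTri a 0 0.
Definition tri_in22 (b : B) : T := MkTri 0 0 b.

Fact tri11_is_linear : linear (@tri11 R A B M). Proof. by []. Qed.
Fact tri12_is_linear : linear (@tri12 R A B M). Proof. by []. Qed.
Fact tri22_is_linear : linear (@tri22 R A B M). Proof. by []. Qed.

Fact tri_in11_is_linear : linear tri_in11.
Proof. by move=> r a a'; congr MkTri => //=; rewrite scaler0 addr0. Qed.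

Fact tri_in22_is_linear : linear tri_in22.
Proof. by move=> r b b'; congr MkTri => //=; rewrite scaler0 addr0. Qed.

HB.instance Definition _ :=
  GRing.isLinear.Build R T A *:%R (@tri11 R A B M) tri11_is_linear.
HB.instance Definition _ :=
  GRing.isLinear.Build R T M *:%R (@tri12 R A B M) tri12_is_linear.
HB.instance Definition _ :=
  GRing.isLinear.Build R T B *:%R (@tri22 R A B M) tri22_is_linear.
HB.instance Definition _ :=
  GRing.isLinear.Build R A T *:%R tri_in11 tri_in11_is_linear.
HB.instance Definition _ :=
  GRing.isLinear.Build R B T *:%R tri_in22 tri_in22_is_linear.

(* Right multiplication makes a module of the bundled algebra, not of its
   carrier type T, and the multiplier predicates take psi between modules. *)
Local Notation TA := (PzAlgebra.clone R T _).

Variable psi : {linear TA -> TA}.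

Definition corner11 : {linear A -> A} := (@tri11 R A B M \o psi) \o tri_in11.
Definition corner12 : {linear B -> M} := (@tri12 R A B M \o psi) \o tri_in22.
Definition corner22 : {linear B -> B} := (@tri22 R A B M \o psi) \o tri_in22.

Hypothesis psi_loc : local_left_multiplier psi.

Lemma corner11_local : local_left_multiplier corner11.
Proof. by move=> a; have [x /= ->] := psi_loc (tri_in11 a); exists (tri11 x). Qed.

Lemma corner12_local : local_left_multiplier corner12.
Proof.
move=> b; have [x /= ->] := psi_loc (tri_in22 b); exists (tri12 x) => /=.
by rewrite lact0r add0r.
Qed.

Lemma corner22_local : local_left_multiplier corner22.
Proof. by move=> b; have [x /= ->] := psi_loc (tri_in22 b); exists (tri22 x). Qed.

Lemma psi_in11 (a : A) : psi (tri_in11 a) = tri_in11 (corner11 a).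
Proof.
rewrite /corner11 /=; have [x ->] := psi_loc (tri_in11 a).
by congr MkTri => /=; rewrite ?lact0r ?ract0r ?addr0 ?mulr0.
Qed.

Lemma psi_in22 (b : B) : psi (tri_in22 b) = MkTri 0 (corner12 b) (corner22 b).
Proof.
rewrite /corner12 /corner22 /=; have [x ->] := psi_loc (tri_in22 b).
by congr MkTri => /=; rewrite mulr0.
Qed.

(** Comparing psi on (1, m, 0) and on (1, 0, 0): the entry 1 pins down the
    multiplier that serves for m, so it does not depend on m. *)
Lemma psi_in12 (m : M) :
  psi (MkTri 0 m 0) = MkTri 0 (lact (corner11 1) m) 0.
Proof.
have -> : MkTri 0 m 0 = MkTri 1 m 0 - tri_in11 1 :> T.
  by congr MkTri => /=; rewrite ?subrr ?subr0.
have [x psi_x] := psi_loc (MkTri 1 m 0).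
have [y psi_y] := psi_loc (MkTri 0 m 0).
have x11E : tri11 x = corner11 1.
  have : psi (tri_in11 1 + MkTri 0 m 0) = psi (MkTri 1 m 0).
    by congr (psi _); congr MkTri => /=; rewrite ?addr0 ?add0r.
  rewrite linearD psi_x psi_y psi_in11 => /(congr1 (@tri11 R A B M)) /=.
  by rewrite mulr0 addr0 mulr1.
rewrite linearB psi_x psi_in11; congr MkTri => /=.
- by rewrite mulr1 x11E subrr.
- by rewrite ract0r addr0 subr0 x11E.
- by rewrite mulr0 subr0.
Qed.

Lemma left_multiplier_of_corners :
  left_multiplier corner11 -> left_multiplier corner12 ->
  left_multiplier corner22 -> left_multiplier psi.
Proof.
move=> mul11 mul12 mul22.
have psiE a m b : psi (MkTri a m b) =
    MkTri (corner11 a) (lact (corner11 1) m + corner12 b) (corner22 b).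
  have -> : MkTri a m b = tri_in11 a + MkTri 0 m 0 + tri_in22 b :> T.
    by congr MkTri => /=; rewrite ?addr0 ?add0r.
  rewrite !linearD psi_in11 psi_in12 psi_in22.
  by congr MkTri => /=; rewrite ?addr0 ?add0r.
case=> a m b; rewrite psiE.
have -> : psi 1 = MkTri (corner11 1) (corner12 1) (corner22 1).
  by rewrite [LHS]psiE lact0r add0r.
congr MkTri => /=; [exact: mul11 | | exact: mul22].
by congr (_ + _); apply: mul12.
Qed.

End TriangularCorners.

Theorem theorem3p11 (R : comPzRingType) (A B : pzAlgType R) (M : bimodType A B)
    (hA : SLIP A) (hB : SLIP B)
    (hM : forall psi : {linear B -> M},
        local_left_multiplier psi -> left_multiplier psi) :
  SLIP (Tri A M B).
Proof.
move=> psi /LIP_iff_local_left_multiplier psi_loc.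
apply: left_multiplier_of_corners => //.
- by apply/hA/LIP_iff_local_left_multiplier/corner11_local.
- exact/hM/corner12_local.
- by apply/hB/LIP_iff_local_left_multiplier/corner22_local.
Qed.
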